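(* For every positive integer $q$, $$\#M\big(\mathcal{A}_q^{(B,\mathbf b)}\big)=\sum_{J\subseteq[m]}(-1)^{\#J}\tilde{d}_J(q)\,q^{n-r(J)}.$$ Moreover, there exists a quasi-polynomial $\chi^{\mathrm{quasi}}\big(\mathcal{A}^{(B,\mathbf b)},q\big)$ in $q$ with $\rho_C$ as a period such that $\#M\big(\mathcal{A}^{(B,\mathbf b)}_q\big)=\chi^{\mathrm{quasi}}\big(\mathcal{A}^{(B,\mathbf b)},q\big)$ for all integers $q>q_0$. More precisely, $\chi^{\mathrm{quasi}}\big(\mathcal{A}^{(B,\mathbf b)},q\big)$ has the form $$\chi^{\mathrm{quasi}}\big(\mathcal{A}^{(B,\mathbf b)},q\big)=\sum_{J\subseteq[m],\ \bar r(J)=r(J)}(-1)^{\#J}\tilde{d}_J(q)\,q^{n-r(J)}.$$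
   Context: Let $A$ be an $m\times n$ integer matrix with rows $\boldsymbol\alpha_1^T,\dots,\boldsymbol\alpha_m^T$, $B$ an $l\times n$ integer matrix ($l=0$ is allowed: no equations), $\mathbf a=(a_1,\dots,a_m)^T\in\mathbb{Z}^m$, $\mathbf b\in\mathbb{Z}^l$, and $[m]=\{1,\dots,m\}$. For a positive integer $q$, $\mathbb{Z}_q=\mathbb{Z}/q\mathbb{Z}$ and $[\cdot]_q$ is the entrywise reduction modulo $q$. Put $V_q(B,\mathbf b)=\{\mathbf x\in\mathbb{Z}_q^n : [B]_q\mathbf x=[\mathbf b]_q\}$ (possibly empty), $H_{i,q}^{(B,\mathbf b)}=\{\mathbf x\in V_q(B,\mathbf b): [\boldsymbol\alpha_i^T]_q\mathbf x=[a_i]_q\}$, and $M\big(\mathcal{A}_q^{(B,\mathbf b)}\big)=V_q(B,\mathbf b)\setminus\bigcup_{i=1}^m H_{i,q}^{(B,\mathbf b)}$. For $J\subseteq[m]$, let $A_J$ and $\mathbf a_J$ consist of the rows of $A$ and entries of $\mathbf a$ indexed by $J$; $C_J=\begin{bmatrix}B\\ A_J\end{bmatrix}$, $\mathbf c_J=\begin{bmatrix}\mathbf b\\ \mathbf a_J\end{bmatrix}$, $\bar C_J=[C_J\ \mathbf c_J]$; $r(J)=\operatorname{rank}C_J$, $\bar r(J)=\operatorname{rank}\bar C_J$ (ranks over $\mathbb{Q}$). The invariant factors of an integer matrix are the nonzero diagonal entries (taken positive, each dividing the next) of its Smith normal form; let $d_{J,1}\mid\cdots\mid d_{J,r(J)}$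 be those of $C_J$ and $\bar d_{J,1}\mid\cdots\mid\bar d_{J,\bar r(J)}$ those of $\bar C_J$. Put $\rho_C=\operatorname{lcm}\{d_{J,r(J)}: J\subseteq[m],\ \bar r(J)=r(J)\}$ and $q_0=\max\{\bar d_{J,\bar r(J)}: J\subseteq[m],\ \bar r(J)=r(J)+1\}$, with $q_0=0$ if no such $J$ exists; $d_{J,0}=1$ and the lcm of the empty set is $1$. Let $d_J(q)=\prod_{j=1}^{r(J)}\gcd(d_{J,j},q)$, and let $\tilde d_J(q)=d_J(q)$ if $\gcd(q,d_{J,j})=\gcd(q,\bar d_{J,j})$ for all $j=1,\dots,\bar r(J)$, and $\tilde d_J(q)=0$ otherwise, where $d_{J,\bar r(J)}:=0$ if $\bar r(J)=r(J)+1$ (and $\gcd(q,0)=q$). A function $f$ is a quasi-polynomial with period $\rho\in\mathbb{Z}_{>0}$ if there are polynomials $f_1,\dots,f_\rho\in\mathbb{Q}[t]$ such that $f(q)=f_j(q)$ for every positive integer $q\equiv j\pmod\rho$. *)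

(* Defs.v *)
From HB Require Import structures.
From mathcomp Require Import all_boot all_order all_algebra.

Set Implicit Arguments.
Unset Strict Implicit.
Unset Printing Implicit Defensive.

Import Order.TTheory GRing.Theory Num.Theory.
Local Open Scope ring_scope.

(* The library's 'Z_q is Z/2Z when q = 1. [Zmod q] is Z/qZ for every q > 0,    *)
(* including the zero ring for q = 1 (q = 0 is junk).                          *)
Definition Zmod (q : nat) : Type := 'I_q.-1.+1.

HB.instance Definition _ q := Finite.on (Zmod q).
HB.instance Definition _ q := GRing.Zmodule.on (Zmod q).
HB.instance Definition _ q :=
  GRing.Zmodule_isComPzRing.Build (Zmod q)
    (@Zp_mulA _) (@Zp_mulC _) (@Zp_mul1z _) (@Zp_mul_addl _).

Definition redmx (q : nat) {k p : nat} (M : 'M[int]_(k, p)) : 'M[Zmod q]_(k, p) :=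
  map_mx intr M.

Definition Vq {n l} (B : 'M[int]_(l, n)) (b : 'cV[int]_l) (q : nat) :
    {set 'cV[Zmod q]_n} :=
  [set x | redmx q B *m x == redmx q b].

Definition Hq {m n l} (A : 'M[int]_(m, n)) (a : 'cV[int]_m)
    (B : 'M[int]_(l, n)) (b : 'cV[int]_l) (q : nat) (i : 'I_m) :
    {set 'cV[Zmod q]_n} :=
  [set x in Vq B b q | redmx q (row i A) *m x == redmx q (row i a)].

Definition Mq {m n l} (A : 'M[int]_(m, n)) (a : 'cV[int]_m)
    (B : 'M[int]_(l, n)) (b : 'cV[int]_l) (q : nat) : {set 'cV[Zmod q]_n} :=
  Vq B b q :\: \bigcup_(i < m) Hq A a B b q i.

(* [s] lists the nonzero diagonal entries of a Smith normal form of [M]; the   *)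
(* diagonal entries beyond [size s] are 0.                                     *)
Definition smith_form {k p} (M : 'M[int]_(k, p))
    (LRs : 'M[int]_k * 'M[int]_p * seq nat) : bool :=
  let: (L, R, s) := LRs in
  [&& L \in unitmx, R \in unitmx, (size s <= minn k p)%N,
      sorted dvdn s, all (fun e => 0 < e)%N s &
      M == L *m (\matrix_(i, j) ((nth 0%N s i)%:Z *+ (i == j :> nat))) *m R].

Lemma nth_filter_dvdz (d : seq int) (i : nat) :
  sorted dvdz d -> [seq x <- d | x != 0]`_i = d`_i.
Proof.
elim: d i => // x d IHd i /= px.
have [x0|nzx] := eqVneq x 0; last by case: i => //= i; rewrite IHd ?(path_sorted px).
have d0 y : y \in d -> y = 0.
  move=> dy; have tr : transitive dvdz by move=> v u w; apply: dvdz_trans.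
  have /allP/(_ y dy) := order_path_min tr px.
  by rewrite x0 -[dvdz 0 y]/(0 %| y)%Z dvd0z => /eqP.
have -> : [seq y <- d | y != 0] = [::].
  by rewrite (eq_in_filter (a2 := pred0)) ?filter_pred0 // => y /d0 ->; rewrite eqxx.
rewrite nth_nil; case: i => [|i] //=.
by have [/(mem_nth 0)/d0 ->|/(nth_default 0) ->] := ltnP i (size d).
Qed.

Lemma smith_form_exists {k p} (M : 'M[int]_(k, p)) : exists LRs, smith_form M LRs.
Proof.
have [L uL [R uR [d d_dvd defM]]] := int_Smith_normal_form M.
pose d1 := take (minn k p) d; pose s := [seq `|x|%N | x <- d1 & x != 0].
have tr : transitive dvdz by move=> v u w; apply: dvdz_trans.
have d1_dvd : sorted dvdz d1 by apply: take_sorted.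
have nth_s i : (nth 0%N s i)%:Z = `|d1`_i|.
  rewrite -abszE -[in RHS](nth_filter_dvdz i d1_dvd).
  have [lti|gei] := ltnP i (size [seq x <- d1 | x != 0]).
    by rewrite (nth_map 0).
  by rewrite !nth_default ?size_map.
pose e i : int := (-1) ^+ (d1`_i < 0)%R.
pose D : 'M[int]_k := diag_mx (\row_i e i).
have uD : D \in unitmx.
  suff DD : D *m D = 1%:M by have [] := mulmx1_unit DD.
  apply/matrixP => i j; rewrite mul_diag_mx !mxE.
  by rewrite mulrnAr /e; case: (_ < 0)%R; rewrite ?expr1 ?expr0 ?mulrNN mulr1.
exists (L *m D, R, s); rewrite /smith_form unitmx_mul uL uD uR /=.
apply/and4P; split.
- rewrite size_map (leq_trans (size_subseq (filter_subseq _ _))) //.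
  by rewrite size_take_min geq_minl.
- rewrite sorted_map; apply: (sub_sorted (e := dvdz)) => //.
  exact: sorted_filter.
- apply/allP => _ /mapP[x + ->]; rewrite mem_filter => /andP[nzx _].
  by rewrite absz_gt0.
- rewrite {1}defM -mulmxA -[X in _ == X]mulmxA -mulmxA; apply/eqP.
  congr (L *m _); rewrite mulmxA; congr (_ *m R).
  apply/matrixP => i j; rewrite mul_diag_mx !mxE mulrnAr nth_s.
  have [eqij|] := eqVneq (i : nat) j; last by rewrite !mulr0n.
  by rewrite !mulr1n /e -intEsign nth_take // leq_min ltn_ord eqij ltn_ord.
Qed.

(* By uniqueness of the Smith normal form, the chosen list depends only on [M]. *)
Definition inv_factors {k p} (M : 'M[int]_(k, p)) : seq nat :=
  (xchoose (smith_form_exists M)).2.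

(* The [j]-th invariant factor, counted from 1; by convention it is 1 for      *)
(* [j = 0] and 0 for [j] larger than the number of invariant factors.          *)
Definition inv_factor {k p} (M : 'M[int]_(k, p)) (j : nat) : nat :=
  nth 0%N (1%N :: inv_factors M) j.

Definition rankQ {k p} (M : 'M[int]_(k, p)) : nat :=
  \rank (map_mx intr M : 'M[rat]_(k, p)).

Definition rows_in {m n} (A : 'M[int]_(m, n)) (J : {set 'I_m}) : 'M[int]_(#|J|, n) :=
  rowsub (enum_val (A := mem J)) A.

Definition CJ {m n l} (A : 'M[int]_(m, n)) (B : 'M[int]_(l, n))
    (J : {set 'I_m}) : 'M[int]_(l + #|J|, n) :=
  col_mx B (rows_in A J).

Definition CbarJ {m n l} (A : 'M[int]_(m, n)) (a : 'cV[int]_m)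
    (B : 'M[int]_(l, n)) (b : 'cV[int]_l) (J : {set 'I_m}) :
    'M[int]_(l + #|J|, n + 1) :=
  row_mx (CJ A B J) (col_mx b (rows_in a J)).

Definition rJ {m n l} (A : 'M[int]_(m, n)) (B : 'M[int]_(l, n))
    (J : {set 'I_m}) : nat := rankQ (CJ A B J).

Definition rbarJ {m n l} (A : 'M[int]_(m, n)) (a : 'cV[int]_m)
    (B : 'M[int]_(l, n)) (b : 'cV[int]_l) (J : {set 'I_m}) : nat :=
  rankQ (CbarJ A a B b J).

Definition rhoC {m n l} (A : 'M[int]_(m, n)) (a : 'cV[int]_m)
    (B : 'M[int]_(l, n)) (b : 'cV[int]_l) : nat :=
  \big[lcmn/1%N]_(J : {set 'I_m} | rbarJ A a B b J == rJ A B J)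
    inv_factor (CJ A B J) (rJ A B J).

Definition q0 {m n l} (A : 'M[int]_(m, n)) (a : 'cV[int]_m)
    (B : 'M[int]_(l, n)) (b : 'cV[int]_l) : nat :=
  (\max_(J : {set 'I_m} | rbarJ A a B b J == (rJ A B J).+1)
    inv_factor (CbarJ A a B b J) (rbarJ A a B b J))%N.

Definition dJ {m n l} (A : 'M[int]_(m, n)) (B : 'M[int]_(l, n))
    (J : {set 'I_m}) (q : nat) : nat :=
  (\prod_(1 <= j < (rJ A B J).+1) gcdn (inv_factor (CJ A B J) j) q)%N.

(* If rbar(J) = r(J) + 1, the index [j = rbar(J)] exceeds the number r(J) of   *)
(* invariant factors of C_J, so [inv_factor] returns the conventional value 0. *)
Definition dtildeJ {m n l} (A : 'M[int]_(m, n)) (a : 'cV[int]_m)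
    (B : 'M[int]_(l, n)) (b : 'cV[int]_l) (J : {set 'I_m}) (q : nat) : nat :=
  if all (fun j => gcdn q (inv_factor (CJ A B J) j) ==
                   gcdn q (inv_factor (CbarJ A a B b J) j))
         (iota 1 (rbarJ A a B b J))
  then dJ A B J q else 0%N.

(* The value of [f] at 0 is irrelevant; [fs 0] is not used. *)
Definition quasi_polynomial (rho : nat) (f : nat -> rat) : Prop :=
  (0 < rho)%N /\
  exists fs : nat -> {poly rat},
    forall j q : nat, (1 <= j <= rho)%N -> (0 < q)%N -> q = j %[mod rho] ->
      f q = (fs j).[q%:R].

(* Main.v *)
(* Inclusion-exclusion reduces the count to the solutions of C_J x = c_J mod q.
   Over Z_q the Smith form gives #ker(t C) = prod_(j < n) gcd(q, t d_j), hence
   #im(t C) for every t. The system is solvable iff im C = im [C c]. If so, the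
   products prod_j gcd(q, t d_j) and prod_j gcd(q, t dbar_j) agree for every t,
   and t = q / gcd(q, d_i) recovers gcd(q, d_i) = gcd(q, dbar_i) by induction on
   i; conversely, equal gcds give im C and im [C c] the same size, so these
   nested sets are equal.
   If rbar(J) = r(J), then the last invariant factor of [C c] divides that of C
   (the latter kills the torsion of Z^k / im C), so dtilde_J(q) depends only on
   q mod rho_C. If rbar(J) = r(J) + 1, then the condition at j = rbar(J) reads
   q = gcd(q, dbar_j), which fails for q > q_0. *)
Require Import Defs.
From mathcomp Require Import all_boot all_order all_algebra.
Import GRing.Theory Num.Theory.
Local Open Scope ring_scope.

(** * Counting in finite abelian groups *)

(** A nonempty fibre is a coset of the kernel: translation by [- x0], for a preimage [x0] of [y],
    carries it onto the kernel. *)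
Lemma card_fiber_morph (U V : finZmodType) (f : U -> V) (y : V) :
    {morph f : x z / x - z} ->
  #|[set x | f x == y]| =
    if y \in f @: setT then #|[set x | f x == 0]| else 0%N.
Proof.
move=> fB; case: ifPn => [/imsetP[x0 _ ->]|yNf]; last first.
  apply/eqP; rewrite cards_eq0; apply/eqP/setP => x; rewrite !inE.
  by apply: contraNF yNf => /eqP <-; rewrite imset_f.
rewrite -(card_imset [set x | f x == f x0] (addIr (- x0))).
apply: eq_card => z; rewrite inE; apply/imsetP/idP => [[x + ->]|fz0].
  by rewrite inE fB => /eqP ->; rewrite subrr.
exists (z + x0); last by rewrite addrK.
by rewrite inE -subr_eq0 -fB addrK.
Qed.

Lemma card_im_ker (U V : finZmodType) (f : U -> V) :
  {morph f : x z / x - z} ->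
  (#|f @: setT| * #|[set x | f x == 0%R]| = #|U|)%N.
Proof.
move=> fB; rewrite -[RHS]sum1_card.
rewrite (partition_big f (mem (f @: setT))) => [|x _]; last exact: imset_f.
rewrite -sum_nat_const; apply: eq_bigr => y yf.
transitivity #|[set x | f x == y]|; first by rewrite (card_fiber_morph _ _ f y) // yf.
by rewrite sum1_card -[RHS]cardsE; apply: eq_card => x; rewrite !inE.
Qed.

(** With [e = q / gcd(d, q)], the multiple [y *+ d] vanishes mod [q] exactly when [e] divides [y],
    and [q / e] residues are multiples of [e]. *)
Lemma card_Zmod_annihilator (q d : nat) : (0 < q)%N ->
  #|[set y : Zmod q | y *+ d == 0]| = gcdn d q.
Proof.
move=> q0; have g0 : (0 < gcdn d q)%N by rewrite gcdn_gt0 q0 orbT.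
have dq := dvdn_gcdr d q; set e := (q %/ gcdn d q)%N.
have annE (y : Zmod q) : (y *+ d == 0) = (e %| y)%N.
  rewrite /e -[RHS](dvdn_pmul2r g0) divnK // muln_gcdr dvdn_gcd (dvdn_mull y (dvdnn q)).
  rewrite andbT -val_eqE /= (_ : val (y *+ d) = ((y * d) %% q)%N) //.
  by rewrite (Zp_mulrn y d) /=; apply: (congr1 (modn _)); apply: prednK.
rewrite (eq_finset _ annE) -sum1dep_card big_mkcond /=.
rewrite (eq_bigr (fun i : 'I_q.-1.+1 => (e %| i : nat))); last by move=> i _; case: ifP.
rewrite -(big_mkord xpredT (fun i => (e %| i : nat))) prednK //.
(* [divn_count_dvd] counts from 1 to [q], while the residues run from 0 to [q - 1]; the end terms 0
   and [q] are both multiples of [e]. *)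
have := divn_count_dvd e q; rewrite divnA // mulKn // => ->.
rewrite [RHS]big_nat_recr //= [LHS]big_ltn //= dvdn0 /e dvdn_div //.
by rewrite addnC.
Qed.

Lemma card_cV_coord (T : finZmodType) (p : nat) (P : 'I_p -> pred T) :
  #|[set x : 'cV[T]_p | [forall j, P j (x j 0)]]| = (\prod_(j < p) #|P j|)%N.
Proof.
transitivity #|family P|; last first.
  by rewrite card_family foldrE big_map big_enum.
rewrite -[RHS]cardsE.
pose h (x : 'cV[T]_p) := [ffun j => x j 0].
have hbij : bijective h.
  exists (fun f : {ffun 'I_p -> T} => \col_j f j) => [x|f].
    by apply/colP => j; rewrite mxE ffunE.
  by apply/ffunP => j; rewrite ffunE mxE.
rewrite -(on_card_preimset (f := h)); last exact: onW_bij.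
apply: eq_card => x; rewrite !inE; apply/forallP/familyP => Px j.
  by rewrite ffunE; apply: Px.
by have := Px j; rewrite ffunE.
Qed.

(** * Kernels modulo [q] from the Smith form *)

Definition diag_seq (k p : nat) (s : seq nat) : 'M[int]_(k, p) :=
  \matrix_(i, j) ((nth 0%N s i)%:Z *+ (i == j :> nat)).

Lemma inv_factorsP (k p : nat) (M : 'M[int]_(k, p)) :
  exists L R, [/\ L \in unitmx, R \in unitmx &
    M = L *m diag_seq k p (inv_factors M) *m R].
Proof.
rewrite /inv_factors; case: xchoose (xchooseP (smith_form_exists M)).
by move=> [L R] s /and5P[uL uR _ _ /andP[_ /eqP defM]]; exists L, R.
Qed.

Lemma inv_factors_wf (k p : nat) (M : 'M[int]_(k, p)) :
  [/\ (size (inv_factors M) <= minn k p)%N, sorted dvdn (inv_factors M)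
    & all (fun e => 0 < e)%N (inv_factors M)].
Proof.
rewrite /inv_factors; case: xchoose (xchooseP (smith_form_exists M)).
by move=> [L R] s /and5P[_ _ ? ? /andP[? _]].
Qed.

Lemma redmxM (q k p r : nat) (M : 'M[int]_(k, p)) (N : 'M[int]_(p, r)) :
  redmx q (M *m N) = redmx q M *m redmx q N.
Proof. exact: map_mxM. Qed.

Lemma redmxKV (q p : nat) (R : 'M[int]_p) : R \in unitmx ->
  redmx q R *m redmx q (invmx R) = 1%:M /\
  redmx q (invmx R) *m redmx q R = 1%:M.
Proof.
by move=> uR; rewrite -!redmxM mulmxV // mulVmx // /redmx map_mx1.
Qed.

(** The matrix is rectangular, so [i] may exceed the height of [x], hence [insub]; the bound on
    [size s] makes the multiplier 0 there. The statement serves over [Zmod q], [rat] and [int]. *)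
Lemma diag_seq_mul (R : pzRingType) (k p r : nat) (s : seq nat)
    (x : 'M[R]_(p, r)) i j : (size s <= p)%N ->
  (map_mx intr (diag_seq k p s) *m x) i j =
    (if insub (i : nat) is Some i' then x i' j else 0) *+ nth 0%N s i.
Proof.
move=> sp; rewrite mxE; case: insubP => [i' _ ii'|].
  rewrite (bigD1 i') //= !mxE ii' eqxx mulr1n big1 ?addr0 => [|m mi].
    by rewrite -pmulrn mulr_natl.
  rewrite !mxE -ii' (_ : _ == _ = false) ?mulr0n ?mul0r //.
  by apply: contraNF mi => /eqP /val_inj ->.
rewrite -leqNgt => pi; rewrite nth_default ?(leq_trans sp) // mulr0n.
by rewrite big1 // => m _; rewrite !mxE nth_default ?(leq_trans sp) // mul0rn mul0r.
Qed.

(** The unit [L] cancels and [R] is a bijective change of coordinates, so the system decouples into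
    [y_j *+ (s_j * t) = 0]. Coordinates past the last invariant factor have [s_j = 0] and are
    free. *)
Lemma card_ker_redmx (k p q t : nat) (M : 'M[int]_(k, p)) : (0 < q)%N ->
  #|[set x : 'cV[Zmod q]_p | (redmx q M *m x) *+ t == 0]| =
  (\prod_(j < p) gcdn (nth 0 (inv_factors M) j * t) q)%N.
Proof.
move=> q0; have [L [R [uL uR defM]]] := inv_factorsP _ _ M.
have [] := inv_factors_wf _ _ M; rewrite leq_min => /andP[szk szp] _ _.
set s := inv_factors M in defM szk szp *; rewrite {}defM.
have [LV VL] := redmxKV q _ _ uL; have [RV VR] := redmxKV q _ _ uR.
pose h (x : 'cV[Zmod q]_p) := redmx q R *m x.
have hbij : bijective h.
  by exists (mulmx (redmx q (invmx R))) => x; rewrite /h mulmxA ?VR ?RV mul1mx.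
transitivity #|h @^-1: [set y : 'cV[Zmod q]_p |
    [forall j, y j 0 *+ (nth 0%N s j * t) == 0]]|.
  apply: eq_card => x; rewrite !inE !redmxM -2!mulmxA -/(h x).
  rewrite -scaler_nat scalemxAr.
  set z := (_ *: _); have -> : (redmx q L *m z == 0) = (z == 0).
    apply/eqP/eqP => [Lz|->]; last by rewrite mulmx0.
    by rewrite -[z]mul1mx -VL -mulmxA Lz mulmx0.
  apply/eqP/forallP => [z0 j|hj].
    have [js|sj] := ltnP j (size s); last by rewrite nth_default // mul0n.
    have := congr1 (fun m : 'cV_k => m (Ordinal (leq_trans js szk)) 0) z0.
    rewrite mxE diag_seq_mul //= [X in _ = X]mxE mulr_natl mulrnA.
    by rewrite (insubT (fun i => i < p)%N (ltn_ord j)) /= => <-; rewrite (_ : Sub _ _ = j) //; apply: val_inj.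
  apply/colP => i; rewrite [LHS]mxE diag_seq_mul // [RHS]mxE mulr_natl.
  case: insubP => [i' _ ii'|_]; last by rewrite !mul0rn.
  by rewrite -mulrnA -ii'; apply/eqP/hj.
rewrite on_card_preimset; last exact: onW_bij.
rewrite (card_cV_coord _ _ (fun j y => y *+ (nth 0%N s j * t) == 0)).
apply: eq_bigr => j _; rewrite -(card_Zmod_annihilator _ _ q0).
by rewrite -[LHS]cardsE; apply: eq_card => y; rewrite !inE.
Qed.

(** * Recovering gcds from products of gcds *)

(** Shows that gcd(x t, q) is determined by [t] and gcd(x, q), so that factors whose gcds already
    agree can be cancelled for every [t]. *)
Lemma gcdnMl_gcdl (x t q : nat) : gcdn (gcdn x q * t) q = gcdn (x * t) q.
Proof. by rewrite muln_gcdl -gcdnA [gcdn (q * t) q]gcdnC gcdnMr. Qed.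

(* Multiplying by t = q / gcd(f i, q) turns the factors of index j >= i on the
   left into q, their largest possible value. *)
Lemma gcdn_chain_dvd (N q i : nat) (f g : nat -> nat) : (0 < q)%N -> (i < N)%N ->
    {homo f : j k / (j <= k)%N >-> (j %| k)%N} ->
    (forall j, (j < i)%N -> gcdn (f j) q = gcdn (g j) q) ->
    (forall t, \prod_(0 <= j < N) gcdn (f j * t) q =
               \prod_(0 <= j < N) gcdn (g j * t) q)%N ->
  (gcdn (f i) q %| g i)%N.
Proof.
move=> q0 iN fdvd eq_lti eq_prod; set d := gcdn (f i) q.
have d0 : (0 < d)%N by rewrite gcdn_gt0 q0 orbT.
have dq : (d %| q)%N := dvdn_gcdr _ _.
pose t := (q %/ d)%N; have qE : q = (d * t)%N by rewrite /t mulnC divnK.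
have pos (h : nat -> nat) u v : (0 < \prod_(u <= j < v) gcdn (h j * t) q)%N.
  by apply: prodn_gt0 => j; rewrite gcdn_gt0 q0 orbT.
have f_ge j : (i <= j)%N -> gcdn (f j * t) q = q.
  move=> ij; apply/gcdn_idPr; rewrite {1}qE dvdn_pmul2r.
    exact: dvdn_trans (dvdn_gcdl _ _) (fdvd _ _ ij).
  by have := q0; rewrite {1}qE muln_gt0 => /andP[].
have split_i h : (\prod_(0 <= j < N) h j)%N =
    (\prod_(0 <= j < i) h j * \prod_(i <= j < N) h j)%N.
  exact: big_cat_nat (leq0n i) (ltnW iN).
have := eq_prod t; rewrite !split_i.
rewrite (eq_big_nat _ _ (F2 := fun j => gcdn (g j * t) q)); last first.
  by move=> j /= ji; rewrite -gcdnMl_gcdl eq_lti // gcdnMl_gcdl.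
move/eqP; rewrite eqn_pmul2l // => /eqP; rewrite !(big_ltn iN) f_ge //.
set R := (\prod_(_ <= j < _) gcdn (f j * t) q)%N => E.
(* From [i] on, every factor for [f] equals [q] and every factor for [g] is at most [q]; equal
   products then leave no room for a smaller factor of [g] at [i]. *)
have q_le : (q <= gcdn (g i * t) q)%N.
  rewrite -(leq_pmul2r (pos f i.+1 N)) -/R E leq_mul2l; apply/orP; right.
  rewrite /R !big_seq; apply: leq_prod => j; rewrite mem_index_iota => /andP[ij _].
  by rewrite (f_ge j (ltnW ij)) dvdn_leq // dvdn_gcdr.
have : (q %| g i * t)%N.
  by apply/gcdn_idPr/eqP; rewrite eqn_leq q_le dvdn_leq // dvdn_gcdr.
rewrite {1}qE dvdn_pmul2r //.
by have := q0; rewrite {1}qE muln_gt0 => /andP[].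
Qed.

(** Strong induction on [i]: [gcdn_chain_dvd], applied in both directions, makes the two gcds divide
    each other. *)
Lemma gcdn_chain_eq (N q : nat) (f g : nat -> nat) : (0 < q)%N ->
    {homo f : j k / (j <= k)%N >-> (j %| k)%N} ->
    {homo g : j k / (j <= k)%N >-> (j %| k)%N} ->
    (forall t, \prod_(0 <= j < N) gcdn (f j * t) q =
               \prod_(0 <= j < N) gcdn (g j * t) q)%N ->
  forall i, (i < N)%N -> gcdn (f i) q = gcdn (g i) q.
Proof.
move=> q0 fdvd gdvd eq_prod; elim/ltn_ind => i IH iN.
have eq_lti j : (j < i)%N -> gcdn (f j) q = gcdn (g j) q.
  by move=> ji; apply: IH ji (ltn_trans ji iN).
apply/eqP; rewrite eqn_dvd !dvdn_gcd !dvdn_gcdr !andbT.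
rewrite (gcdn_chain_dvd N _ _ f) //= (gcdn_chain_dvd N _ _ g) // => j ji.
by rewrite eq_lti.
Qed.

(** The default value 0 past the end of the list is a multiple of everything, so the divisibility
    chain extends to all indices. *)
Lemma inv_factors_dvd (k p : nat) (M : 'M[int]_(k, p)) :
  {homo nth 0%N (inv_factors M) : i j / (i <= j)%N >-> (i %| j)%N}.
Proof.
have [_ dvd_s _] := inv_factors_wf _ _ M; set s := inv_factors M in dvd_s *.
move=> i j ij; have [js|sj] := ltnP j (size s); last by rewrite [nth _ _ j]nth_default.
by apply: (sorted_leq_nth dvdn_trans dvdnn 0%N dvd_s); rewrite ?inE // (leq_ltn_trans ij).
Qed.

(** * Solvability and number of solutions of [C x = c] modulo [q] *)

Section Solutions.
Variables (k p q : nat) (C : 'M[int]_(k, p)) (c : 'cV[int]_k).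
Hypothesis q_gt0 : (0 < q)%N.
Let Cbar := row_mx C c.
Let im r (M : 'M[int]_(k, r)) t : {set 'cV[Zmod q]_k} :=
  [set (redmx q M *m x) *+ t | x in [set: 'cV[Zmod q]_r]].

Lemma card_im_redmx r (M : 'M[int]_(k, r)) t :
  (#|im r M t| * \prod_(0 <= j < r) gcdn (nth 0 (inv_factors M) j * t) q = q ^ r)%N.
Proof.
rewrite big_mkord -card_ker_redmx //.
transitivity #|{: 'cV[Zmod q]_r}|; last by rewrite card_mx card_ord prednK // muln1.
apply: (card_im_ker _ _ (fun x : 'cV[Zmod q]_r => (redmx q M *m x) *+ t)) => x y.
by rewrite mulmxBr mulrnBl.
Qed.

Lemma redmx_row_mul (x : 'cV[Zmod q]_p) (y : 'cV[Zmod q]_1) :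
  redmx q Cbar *m col_mx x y = redmx q C *m x + redmx q c *m y.
Proof. by rewrite /redmx map_row_mx mul_row_col. Qed.

Lemma im_row_mx t : im p C t \subset im (p + 1) Cbar t.
Proof.
apply/subsetP => _ /imsetP[x _ ->]; apply/imsetP; exists (col_mx x 0) => //.
by rewrite redmx_row_mul mulmx0 addr0.
Qed.

Lemma solvable_im1 :
  (redmx q c \in im p C 1) = (im p C 1 == im (p + 1) Cbar 1).
Proof.
apply/idP/eqP => [|->]; last first.
  apply/imsetP; exists (col_mx 0 1%:M) => //.
  by rewrite redmx_row_mul mulmx0 mulmx1 add0r.
case/imsetP => x0 _; rewrite mulr1n => cE; apply/eqP.
rewrite eqEsubset im_row_mx; apply/subsetP => _ /imsetP[x _ ->].
(* With [c = C x0] mod [q], the value [C x' + c y] equals [C (x' + x0 y)]. *)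
apply/imsetP; exists (usubmx x + x0 *m dsubmx x) => //.
by rewrite -{1}[x]vsubmxK redmx_row_mul cE mulmxDr mulmxA.
Qed.

(** Propagates equality of images from [t = 1] to every [t], as the gcd comparison requires. *)
Lemma im_mulrn r (M : 'M[int]_(k, r)) t : im r M t = [set y *+ t | y in im r M 1].
Proof. by rewrite -imset_comp. Qed.

Lemma solvable_gcdP :
  (redmx q c \in im p C 1) =
  [forall j : 'I_p.+1, gcdn q (nth 0%N (inv_factors C) j) ==
                       gcdn q (nth 0%N (inv_factors Cbar) j)].
Proof.
have [szC _ _] := inv_factors_wf _ _ C.
(* [C] has at most [p] invariant factors, so index [p] contributes gcd(0, q) = [q]; this matches the
   extra column of [Cbar]. *)
have padC t : (#|im p C t| * \prod_(0 <= j < p.+1) gcdn (nth 0 (inv_factors C) j * t) q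
              = q ^ p.+1)%N.
  rewrite big_nat_recr //= nth_default ?mul0n ?gcd0n.
    by rewrite mulnA card_im_redmx expnSr.
  by move: szC; rewrite leq_min => /andP[].
have imbar t : (#|im (p + 1) Cbar t| *
    \prod_(0 <= j < p.+1) gcdn (nth 0 (inv_factors Cbar) j * t) q = q ^ p.+1)%N.
  by rewrite -[p.+1]addn1 card_im_redmx.
rewrite solvable_im1; apply/eqP/forallP => [eqim j|eqg].
  apply/eqP; rewrite gcdnC [RHS]gcdnC.
  apply: (gcdn_chain_eq p.+1) => //; try exact: inv_factors_dvd.
  move=> t; have := imbar t; rewrite -(padC t) [im _ Cbar t]im_mulrn -eqim -im_mulrn.
  move/eqP; rewrite eqn_pmul2l; first by move/eqP.
  by apply/card_gt0P; exists ((redmx q C *m 0) *+ t); apply: imset_f.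
apply/eqP; rewrite eqEcard im_row_mx /=.
have := imbar 1%N; rewrite -(padC 1%N).
rewrite (eq_big_nat _ _ (F2 := fun j => gcdn (nth 0 (inv_factors C) j * 1) q))%N.
  move/eqP; rewrite eqn_pmul2r; first by move/eqP ->.
  by apply: prodn_gt0 => j; rewrite gcdn_gt0 q_gt0 orbT.
move=> j /= jp; rewrite !muln1 gcdnC; have /eqP <- := eqg (Ordinal jp).
by rewrite gcdnC.
Qed.

Lemma card_solutions :
  #|[set x | redmx q C *m x == redmx q c]| =
  (if [forall j : 'I_p.+1, gcdn q (nth 0%N (inv_factors C) j) ==
                       gcdn q (nth 0%N (inv_factors Cbar) j)]
   then \prod_(0 <= j < p) gcdn (nth 0 (inv_factors C) j) q else 0)%N.
Proof.
rewrite -solvable_gcdP (card_fiber_morph _ _ (mulmx (redmx q C))); last first.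
  by move=> x y; rewrite mulmxBr.
have -> : (redmx q c \in mulmx (redmx q C) @: setT) = (redmx q c \in im p C 1).
  by apply/imsetP/imsetP => -[x _ ->]; exists x.
case: ifP => // _; have := card_ker_redmx _ _ _ 1 C q_gt0; rewrite big_mkord.
under [X in _ = X -> _]eq_bigr => j _ do rewrite muln1.
by move=> <-; apply: eq_card => x; rewrite !inE.
Qed.

End Solutions.

(** * Rational rank and the last invariant factor *)

Lemma map_intr_unit (R : comUnitRingType) (k : nat) (L : 'M[int]_k) :
  L \in unitmx -> map_mx intr L \in @unitmx R k.
Proof.
move=> uL; have : map_mx intr L *m map_mx intr (invmx L) = 1%:M :> 'M[R]_k.
  by rewrite -map_mxM mulmxV // map_mx1.
by case/mulmx1_unit.
Qed.

Lemma rankQ_inv_factors (k p : nat) (M : 'M[int]_(k, p)) :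
  rankQ M = size (inv_factors M).
Proof.
have [L [R [uL uR defM]]] := inv_factorsP _ _ M.
have [] := inv_factors_wf _ _ M; rewrite leq_min => /andP[szk szp] _ s_gt0.
set s := inv_factors M in defM szk szp s_gt0 *; rewrite /rankQ {}defM !map_mxM.
rewrite mxrankMfree ?row_free_unit ?map_intr_unit //.
rewrite eqmxMfull ?row_full_unit ?map_intr_unit //.
(* Entries past [size s] are set to 1 to keep the diagonal matrix invertible; [pid_mx] then carries
   the rank. *)
pose e : 'rV[rat]_k := \row_i (if (i < size s)%N then (nth 0 s i)%:R else 1).
have ->: map_mx intr (diag_seq k p s) = diag_mx e *m pid_mx (size s) :> 'M[rat]_(k, p).
  apply/matrixP => i j; rewrite mul_diag_mx !mxE.
  have [ij|] := eqVneq (i : nat) j; last by rewrite mulr0n mulr0.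
  rewrite mulr1n; case: ltnP => [_|si]; first by rewrite mulr1 -pmulrn.
  by rewrite mulr0 nth_default.
rewrite eqmxMfull ?rank_pid_mx // row_full_unit unitmxE det_diag unitfE.
apply/prodf_neq0 => i _; rewrite mxE; case: ltnP => [si|_]; last exact: oner_neq0.
by rewrite pnatr_eq0 -lt0n; apply: (allP s_gt0); apply: mem_nth.
Qed.

(** Lets [diag_seq_mul], stated for the image of an integer matrix in a ring, be used over the
    integers themselves. *)
Lemma map_mx_intz (k p : nat) (M : 'M[int]_(k, p)) : map_mx intr M = M.
Proof. by apply/matrixP => i j; rewrite mxE intz. Qed.

Lemma inv_factor_dvd (k p : nat) (M : 'M[int]_(k, p)) (i j : nat) :
  (i <= j)%N -> (inv_factor M i %| inv_factor M j)%N.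
Proof. by case: i j => [|i] [|j] //= ij; rewrite ?dvd1n //; apply: inv_factors_dvd. Qed.

Lemma inv_factor_gt0 (k p : nat) (M : 'M[int]_(k, p)) (j : nat) :
  (j <= rankQ M)%N -> (0 < inv_factor M j)%N.
Proof.
rewrite rankQ_inv_factors; case: j => //= j jr.
by have [_ _ /allP] := inv_factors_wf _ _ M; apply; apply: mem_nth.
Qed.

Lemma inv_factor_default (k p : nat) (M : 'M[int]_(k, p)) (j : nat) :
  (rankQ M < j)%N -> inv_factor M j = 0%N.
Proof. by rewrite rankQ_inv_factors; case: j => // j rj; apply: nth_default. Qed.

(* The last invariant factor is the exponent of the torsion of Z^k / im M. *)
Lemma last_inv_factor_saturates (k p : nat) (M : 'M[int]_(k, p)) (y : 'cV[int]_k) :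
    (exists x : 'cV[rat]_p, map_mx intr y = map_mx intr M *m x) ->
  exists z, y *+ inv_factor M (rankQ M) = M *m z.
Proof.
case=> x; have [L [R [uL uR defM]]] := inv_factorsP _ _ M.
have [] := inv_factors_wf _ _ M; rewrite leq_min => /andP[szk szp] _ _.
have d_dvd j : (j < size (inv_factors M))%N ->
    (nth 0 (inv_factors M) j %| inv_factor M (rankQ M))%N.
  by move=> js; apply: (inv_factor_dvd _ _ M j.+1); rewrite rankQ_inv_factors.
set d := inv_factor M _ in d_dvd *; set s := inv_factors M in defM szk szp d_dvd.
rewrite {1}defM => yE; pose y' := invmx L *m y.
(* In the coordinates [y' = L^-1 y], rational solvability makes all entries beyond the rank
   vanish. *)
have y'0 (i : 'I_k) : (size s <= i)%N -> y' i 0 = 0.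
  move=> si; apply/eqP; rewrite -(intr_eq0 rat); apply/eqP.
  transitivity ((map_mx intr y' : 'cV[rat]_k) i 0); first by rewrite [RHS]mxE.
  rewrite /y' map_mxM yE !map_mxM -!mulmxA mulmxA -map_mxM mulVmx // map_mx1.
  by rewrite mul1mx diag_seq_mul // nth_default.
(* Each [s_j] divides [d], so the quotients [d / s_j] are exact, and scaling [y'] by them and then
   by the [s_j] multiplies it by [d]. *)
pose s' := [seq (d %/ e)%N | e <- s].
have szs' : size s' = size s by rewrite size_map.
exists (invmx R *m (diag_seq p k s' *m y')).
rewrite defM mulmxA mulmxK // -mulmxA -{1}[y](mulKVmx uL) -/y' -scaler_nat.
rewrite scalemxAr; congr (_ *m _); rewrite -[in RHS](map_mx_intz _ _ (diag_seq k p s)).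
apply/colP => i; rewrite [LHS]mxE diag_seq_mul //.
have [si|si] := leqP (size s) i; first by rewrite y'0 // nth_default // mulr0.
rewrite (insubT (fun j => j < p)%N (leq_trans si szp)) -(map_mx_intz _ _ (diag_seq p k s')).
rewrite diag_seq_mul ?szs' //= insubT //= => ik; rewrite (nth_map 0%N) // -mulrnA divnK ?d_dvd //.
by rewrite mulr_natl; congr (y' _ _ *+ _); apply: val_inj.
Qed.

(** The test vector is [L e_j], with [j] the last index in the Smith form of [M']. It lies in the
    rational column span of [M'], hence of [M], so its multiple by the last factor [d] of [M] lies
    in im [M], inside im [M']. Coordinate [j] then shows that the last factor of [M'] divides
    [d]. *)
Lemma last_inv_factor_dvd (k p p' : nat) (M : 'M[int]_(k, p)) (M' : 'M[int]_(k, p')) :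
    (exists P, M = M' *m P) ->
    (exists X : 'M[rat]_(p, p'), map_mx intr M' = map_mx intr M *m X) ->
  (inv_factor M' (rankQ M') %| inv_factor M (rankQ M))%N.
Proof.
move=> [P MP] [X M'X]; have [L [R [uL uR defM']]] := inv_factorsP _ _ M'.
have [] := inv_factors_wf _ _ M'; rewrite leq_min => /andP[szk szp] _ _.
have := inv_factor_gt0 _ _ M' (rankQ M') (leqnn _); rewrite (rankQ_inv_factors _ _ M').
rewrite /(inv_factor M') /=; set s := inv_factors M' in defM' szk szp *.
(* In rank 0 the last invariant factor is the conventional value 1. *)
have [->|] := eqVneq (size s) 0%N; first by rewrite dvd1n.
rewrite -lt0n => s_gt0; rewrite -(prednK s_gt0) /=; set j := (size s).-1.
have js : (j < size s)%N by rewrite prednK.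
set f := nth _ _ _ => f_gt0.
pose jk := Ordinal (leq_trans js szk); pose jp := Ordinal (leq_trans js szp).
have LDj : diag_seq k p' s *m delta_mx jp 0 = delta_mx jk 0 *+ f :> 'cV[int]_k.
  apply/colP => i; rewrite -colE mulmxnE !mxE; have [->|ij] := eqVneq i jk.
    by rewrite !eqxx mulr1n -[RHS]/(f%:R) natz.
  have ij' : (i == jp :> nat) = false by apply/negbTE.
  by rewrite ij' mul0rn.
have [|z] := last_inv_factor_saturates _ _ M (L *m delta_mx jk 0).
  (* Over the rationals [L e_jk = M' R^-1 (e_jp / f)], and [M' = M X]. *)
  exists (X *m (map_mx intr (invmx R) *m (f%:R^-1 *: delta_mx jp 0))).
  rewrite mulmxA -M'X defM' mulmxA -[in RHS]map_mxM mulmxK //.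
  rewrite -scalemxAr; apply/(canRL (scalerK _)); first by rewrite pnatr_eq0 -lt0n.
  rewrite -(map_delta_mx (intr : int -> rat)) -[RHS]map_mxM -mulmxA LDj.
  by rewrite -[delta_mx jk 0 *+ f]scaler_nat -scalemxAr map_mxZ rmorph_nat.
set d := inv_factor M _; rewrite MP defM' -!mulmxA -scaler_nat scalemxAr.
move/(congr1 (mulmx (invmx L))); rewrite !mulKmx //.
set w := _ *m (P *m z); rewrite -(map_mx_intz _ _ (diag_seq _ _ _)).
move/colP/(_ jk); rewrite diag_seq_mul // [LHS]mxE [delta_mx _ _ _ _]mxE !eqxx mulr1.
rewrite (insubT (fun i => i < p')%N (leq_trans js szp)) /= natz => E.
suff : (f%:Z %| d%:Z)%Z by [].
by apply/dvdzP; eexists; rewrite E -mulr_natr natz.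
Qed.

Lemma gcdn_eq_mod (rho d u v : nat) : (d %| rho)%N -> u = v %[mod rho] ->
  gcdn d u = gcdn d v.
Proof.
move=> d_rho uv; rewrite -[LHS]gcdn_modr -[RHS]gcdn_modr.
by rewrite -(modn_dvdm u d_rho) uv modn_dvdm.
Qed.

Lemma rank_row_mx_cV (F : fieldType) (k p : nat) (C : 'M[F]_(k, p)) (c : 'cV[F]_k) :
  (\rank C <= \rank (row_mx C c) <= (\rank C).+1)%N.
Proof.
rewrite -mxrank_tr -(mxrank_tr (row_mx C c)) tr_row_mx -addsmxE.
rewrite mxrankS ?addsmxSl //= (leq_trans (mxrank_adds_leqif _ _)) //.
by rewrite -[(_ C^T).+1]addn1 leq_add2l rank_leq_row.
Qed.

(** Equal ranks make the nested column spaces coincide; transposes appear because the submodule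
    order compares row spaces. *)
Lemma row_mx_factor (F : fieldType) (k p : nat) (C : 'M[F]_(k, p)) (c : 'cV[F]_k) :
  \rank (row_mx C c) = \rank C -> exists X, row_mx C c = C *m X.
Proof.
move=> eq_rank; have sub : (C^T <= (row_mx C c)^T)%MS.
  by rewrite tr_row_mx -addsmxE addsmxSl.
have := mxrank_leqif_sup sub; rewrite !mxrank_tr eq_rank.
case=> _; rewrite eqxx => /esym /submxP[X /(congr1 trmx)].
by rewrite trmx_mul !trmxK => ->; exists X^T.
Qed.

(** * The systems indexed by [J] and inclusion-exclusion *)

Section Arrangement.
Variables (m n l : nat) (A : 'M[int]_(m, n)) (a : 'cV[int]_m).
Variables (B : 'M[int]_(l, n)) (b : 'cV[int]_l).

Lemma rank_bounds (J : {set 'I_m}) :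
  (rJ A B J <= rbarJ A a B b J <= (rJ A B J).+1)%N.
Proof. by rewrite /rbarJ /rankQ map_row_mx rank_row_mx_cV. Qed.

(** Dropping the last column factors [C_J] through [Cbar_J], and equal ranks give a rational
    factorization the other way. Consequently [rhoC] also controls the invariant factors of
    [Cbar_J]. *)
Lemma inv_factor_row_mx_dvd (J : {set 'I_m}) : rbarJ A a B b J = rJ A B J ->
  (inv_factor (CbarJ A a B b J) (rbarJ A a B b J) %| inv_factor (CJ A B J) (rJ A B J))%N.
Proof.
move=> eq_rank; apply: last_inv_factor_dvd.
  by exists (col_mx 1%:M 0); rewrite mul_row_col mulmx1 mulmx0 addr0.
rewrite /CbarJ map_row_mx; apply: row_mx_factor.
by rewrite -map_row_mx.
Qed.

Definition solJ (q : nat) (J : {set 'I_m}) : {set 'cV[Zmod q]_n} :=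
  [set x | redmx q (CJ A B J) *m x == redmx q (col_mx b (rows_in a J))].

Lemma solJE (q : nat) (J : {set 'I_m}) (x : 'cV[Zmod q]_n) :
  (x \in solJ q J) =
  (x \in Vq B b q) && [forall i, (i \in J) ==> (x \in Hq A a B b q i)].
Proof.
rewrite !inE /redmx !map_col_mx mul_col_mx.
transitivity ((redmx q B *m x == redmx q b) &&
  (redmx q (rows_in A J) *m x == redmx q (rows_in a J))).
  by apply/eqP/andP => [/eq_col_mx[-> ->]|[/eqP ? /eqP ?]] //; congr col_mx.
have [xV|] := boolP (_ == redmx q b) => //=.
have rowE i : (x \in Hq A a B b q i) = ((redmx q A *m x) i 0 == (redmx q a) i 0).
  rewrite !inE xV /= /redmx !map_row -row_mul.
  apply/eqP/eqP => [/rowP/(_ 0)|e]; first by rewrite !mxE.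
  by apply/rowP => j; move: e; rewrite (ord1 j) !mxE.
have entE (i : 'I_#|J|) : (redmx q (rows_in A J) *m x) i 0 = (redmx q A *m x) (enum_val i) 0.
  by rewrite !mxE; apply: eq_bigr => j _; rewrite !mxE.
apply/eqP/forallP => [/colP e i|h].
  apply/implyP => iJ; rewrite rowE; have := e (enum_rank_in iJ i).
  by rewrite entE !mxE enum_rankK_in // => /eqP.
apply/colP => i; rewrite entE.
have /implyP/(_ (enum_valP i)) := h (enum_val i); rewrite rowE => /eqP ->.
by rewrite !mxE.
Qed.

Lemma card_solJ (q : nat) (J : {set 'I_m}) : (0 < q)%N ->
  #|solJ q J| = (dtildeJ A a B b J q * q ^ (n - rJ A B J))%N.
Proof.
move=> q_gt0; rewrite card_solutions //; set C := CJ A B J; set Cbar := CbarJ A a B b J.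
have /andP[rle _] := rank_bounds J.
have [sz _ _] := inv_factors_wf _ _ C.
have [szbar _ _] := inv_factors_wf _ _ Cbar.
have rn : (rJ A B J <= n)%N.
  by rewrite /rJ rankQ_inv_factors; move: sz; rewrite leq_min => /andP[].
have rbarn : (rbarJ A a B b J <= n.+1)%N.
  by rewrite /rbarJ rankQ_inv_factors -[n.+1]addn1; move: szbar; rewrite leq_min => /andP[].
rewrite /dtildeJ; set P := [forall j, _]; set Q := all _ _.
(* [P] tests the zero-based indices up to [n], [Q] only the one-based indices up to [rbarJ]. The
   additional tests compare default zeros, because [rJ <= rbarJ]. *)
have -> : P = Q.
  apply/forallP/allP => [h [|j] // |h j].
    rewrite mem_iota add1n => /andP[_]; rewrite ltnS => jr.
    exact: (h (Ordinal (leq_trans jr rbarn))).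
  have [jr|rj] := ltnP j (rbarJ A a B b J).
    by apply: (h j.+1); rewrite mem_iota.
  by rewrite -/C -/Cbar !nth_default // -rankQ_inv_factors // (leq_trans rle).
case: Q; last by rewrite mul0n.
rewrite (big_cat_nat (leq0n _) rn) /=; congr (_ * _)%N.
  by rewrite /dJ big_add1.
(* Each of the [n - rJ] indices past the rank contributes gcd(0, q) = [q]. *)
rewrite (eq_big_nat _ _ (F2 := fun=> q)) ?prod_nat_const_nat // => j /andP[rj _].
by rewrite nth_default ?gcd0n // -rankQ_inv_factors.
Qed.

(** Pointwise, the indicator of [Mq] is that of [Vq] times the product over [i] of 1 minus the
    indicator of [Hq i]. Expanding this product over subsets [J] and summing over [x] gives the
    formula. *)
Lemma card_Mq_solJ (q : nat) :
  #|Mq A a B b q|%:R = \sum_(J : {set 'I_m}) (-1) ^+ #|J| * #|solJ q J|%:R :> rat.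
Proof.
have cardE (S : {set 'cV[Zmod q]_n}) : #|S|%:R = \sum_x (x \in S)%:R :> rat.
  by rewrite -sum1_card natr_sum big_mkcond; apply: eq_bigr => x _; case: (x \in S).
rewrite cardE; under [RHS]eq_bigr => J _ do rewrite cardE big_distrr /=.
rewrite exchange_big /=; apply: eq_bigr => x _.
transitivity ((x \in Vq B b q)%:R * \prod_i (- (x \in Hq A a B b q i)%:R + 1) : rat).
  rewrite /Mq in_setD andbC -mulnb natrM; congr (_ * _).
  have [/bigcupP[i _ xH]|xNH] := boolP (x \in \bigcup_i Hq A a B b q i).
    by rewrite (bigD1 i) //= xH addNr mul0r.
  rewrite big1 // => i _; rewrite (_ : _ \in _ = false) ?oppr0 ?add0r //.
  by apply: contraNF xNH => xH; apply/bigcupP; exists i.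
rewrite bigA_distr mulr_sumr; apply: eq_big => // J _.
rewrite -big_mkcond /= prodrN mulrCA solJE -mulnb natrM; congr (_ * (_ * _)).
have [/forall_inP h|] := boolP [forall i, (i \in J) ==> (x \in Hq A a B b q i)].
  by rewrite big1 // => i iJ; rewrite h.
rewrite negb_forall => /existsP[i]; rewrite negb_imply => /andP[iJ xNH].
by rewrite (bigD1 i) //= (negPf xNH) mul0r.
Qed.

(** * Periodicity modulo [rhoC] and vanishing beyond [q0] *)

Lemma rhoC_gt0 : (0 < rhoC A a B b)%N.
Proof.
rewrite /rhoC; elim/big_ind: _ => // [u v u0 v0|J _]; first by rewrite lcmn_gt0 u0.
exact: inv_factor_gt0.
Qed.

Lemma dvd_rhoC (J : {set 'I_m}) : rbarJ A a B b J == rJ A B J ->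
  (inv_factor (CJ A B J) (rJ A B J) %| rhoC A a B b)%N.
Proof. by move=> Jr; rewrite /rhoC (bigD1 J) //= dvdn_lcml. Qed.

(** Every gcd occurring in [dtildeJ] involves a divisor of [rhoC]: each invariant factor divides the
    last of its list, and the last one of [Cbar_J] divides that of [C_J]. *)
Lemma dtildeJ_eq_mod (J : {set 'I_m}) (u v : nat) : rbarJ A a B b J == rJ A B J ->
  u = v %[mod rhoC A a B b] -> dtildeJ A a B b J u = dtildeJ A a B b J v.
Proof.
move=> Jr uv; have d_rho := dvd_rhoC J Jr; have rr := eqP Jr.
have dbar_rho := dvdn_trans (inv_factor_row_mx_dvd J rr) d_rho.
have gcdC j : (j <= rJ A B J)%N ->
    gcdn (inv_factor (CJ A B J) j) u = gcdn (inv_factor (CJ A B J) j) v.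
  by move=> jr; apply: gcdn_eq_mod uv; apply: dvdn_trans d_rho; apply: inv_factor_dvd.
have gcdCbar j : (j <= rJ A B J)%N ->
    gcdn (inv_factor (CbarJ A a B b J) j) u = gcdn (inv_factor (CbarJ A a B b J) j) v.
  move=> jr; apply: gcdn_eq_mod uv; apply: dvdn_trans dbar_rho.
  by apply: inv_factor_dvd; rewrite rr.
have -> : dtildeJ A a B b J u =
    if all (fun j => gcdn v (inv_factor (CJ A B J) j) ==
                     gcdn v (inv_factor (CbarJ A a B b J) j))
           (iota 1 (rbarJ A a B b J)) then dJ A B J u else 0%N.
  rewrite /dtildeJ; congr (if _ then _ else _); apply: eq_in_all => j.
  rewrite mem_iota add1n => /andP[_]; rewrite ltnS rr => jr.
  by rewrite ![gcdn u _]gcdnC ![gcdn v _]gcdnC gcdC // gcdCbar.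
rewrite /dtildeJ; case: ifP => // _; apply: eq_big_nat => j /andP[_ jr].
exact: gcdC.
Qed.

Lemma dtildeJ_inconsistent (J : {set 'I_m}) (q : nat) :
    rbarJ A a B b J != rJ A B J -> (q0 A a B b < q)%N ->
  dtildeJ A a B b J q = 0%N.
Proof.
move=> Jr q0q; have /andP[r1 r2] := rank_bounds J.
have rr : rbarJ A a B b J = (rJ A B J).+1 by apply/eqP; rewrite eqn_leq r2 ltn_neqAle eq_sym Jr.
rewrite /dtildeJ; case: ifP => // /allP /(_ (rbarJ A a B b J)).
rewrite mem_iota rr ltnS leqnn => /(_ isT).
(* At index [rJ + 1] the factor of [C_J] is 0 and gcd(q, 0) = [q], so the test says that [q] divides
   a positive number which is at most [q0]. *)
rewrite (inv_factor_default _ _ (CJ A B J)) // gcdn0 => /eqP qE.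
have dbar_gt0 := inv_factor_gt0 _ _ (CbarJ A a B b J) _ (leqnn _).
have dbar_q0 : (inv_factor (CbarJ A a B b J) (rbarJ A a B b J) <= q0 A a B b)%N.
  by rewrite /q0 (bigD1 J) /= ?rr // leq_maxl.
have := leq_ltn_trans dbar_q0 q0q; rewrite ltnNge => /negP[].
by apply: dvdn_leq => //; rewrite rr qE dvdn_gcdr.
Qed.

End Arrangement.

Theorem theorem2p4 (m n l : nat) (A : 'M[int]_(m, n)) (a : 'cV[int]_m)
    (B : 'M[int]_(l, n)) (b : 'cV[int]_l) :
  (forall q : nat, (0 < q)%N ->
     #|Mq A a B b q|%:R =
       \sum_(J : {set 'I_m})
         (-1) ^+ #|J| * (dtildeJ A a B b J q)%:R * q%:R ^+ (n - rJ A B J) :> rat)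
  /\
  exists chi : nat -> rat,
    [/\ quasi_polynomial (rhoC A a B b) chi,
        forall q : nat, (q0 A a B b < q)%N -> #|Mq A a B b q|%:R = chi q
      & forall q : nat, (0 < q)%N ->
          chi q =
            \sum_(J : {set 'I_m} | rbarJ A a B b J == rJ A B J)
              (-1) ^+ #|J| * (dtildeJ A a B b J q)%:R * q%:R ^+ (n - rJ A B J)].
Proof.
have cardM q : (0 < q)%N -> #|Mq A a B b q|%:R = \sum_(J : {set 'I_m})
    (-1) ^+ #|J| * (dtildeJ A a B b J q)%:R * q%:R ^+ (n - rJ A B J) :> rat.
  move=> q_gt0; rewrite card_Mq_solJ; apply: eq_bigr => J _.
  by rewrite card_solJ // natrM natrX mulrA.
split=> //.
exists (fun q => \sum_(J : {set 'I_m} | rbarJ A a B b J == rJ A B J)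
  (-1) ^+ #|J| * (dtildeJ A a B b J q)%:R * q%:R ^+ (n - rJ A B J)); split=> //.
- split; first exact: rhoC_gt0.
  (* The constituent for residue [j] freezes each [dtildeJ] at [j]; only the power of [q] remains
     variable. *)
  exists (fun j => \sum_(J : {set 'I_m} | rbarJ A a B b J == rJ A B J)
    ((-1) ^+ #|J| * (dtildeJ A a B b J j)%:R) *: 'X^(n - rJ A B J)) => j q _ _ qj.
  rewrite horner_sum; apply: eq_bigr => J Jr.
  by rewrite hornerZ hornerXn (dtildeJ_eq_mod _ _ _ _ _ _ _ _ _ _ Jr qj).
- move=> q q0q; rewrite cardM ?(leq_ltn_trans _ q0q) // [RHS]big_mkcond.
  apply: eq_bigr => J _; case: ifPn => // Jr.
  by rewrite (dtildeJ_inconsistent _ _ _ _ _ _ _ _ _ Jr q0q) mulr0 mul0r.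
Qed.
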